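(* (1) Let $P=(V,\le)$ be a poset. Then $\mathrm{age}(\mathrm{Inc}(P))$ is minimal prime if and only if $\mathrm{age}(\mathrm{Comp}(P))$ is minimal prime. Furthermore, $\mathrm{age}(P)$ is minimal prime if and only if $\mathrm{age}(\mathrm{Inc}(P))$ is minimal prime and ${\downarrow}\,\mathrm{Prim}(\mathrm{age}(P))=\mathrm{age}(P)$. (2) Let $B=(V,(\le_1,\le_2))$ be a bichain and $o(B)=(V,\le_1\cap\le_2)$. Then $\mathrm{age}(B)$ is minimal prime if and only if $\mathrm{age}(o(B))$ is minimal prime and ${\downarrow}\,\mathrm{Prim}(\mathrm{age}(B))=\mathrm{age}(B)$.
   Context: For a binary relational structure on $V$ (poset, graph, bichain), a module is a set $A\subseteq V$ such that for every $v\notin A$ and each relation $\rho$, $(v,a)\in\rho\Rightarrow(v,a')\in\rho$ and $(a,v)\in\rho\Rightarrow(a',v)\in\rho$ for all $a,a'\in A$; modules $\emptyset$, singletons and $V$ are trivial; a structure is prime if all modules are trivial. The age of a structure is the class of finite structures embeddable in it (as induced substructures). $\mathrm{Prim}(\mathcal C)$ is the set of prime members of $\mathcal C$, and ${\downarrow}\mathcal X$ is the class of structures embeddable in some member of $\mathcal X$. A hereditary class of finite structures is minimal prime if it contains infinitely many prime members while every proper hereditary subclass contains only finitely many. $\mathrm{Inc}(P)$, $\mathrm{Comp}(P)$: incomparability, comparability graphs. *)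

(* Defs.v *)
From mathcomp Require Import all_boot.
From mathcomp Require Import boolp classical_sets cardinality.
From Stdlib Require Relation_Definitions.

Set Implicit Arguments.
Unset Strict Implicit.
Unset Printing Implicit Defensive.

Local Open Scope classical_set_scope.

(* The type I indexes the relations: one relation (I = unit) for posets and
   graphs, two (I = bool) for bichains. *)
Record structure (I : Type) := Structure {
  carrier :> Type;
  related : I -> carrier -> carrier -> Prop }.

Section Structures.
Variable I : Type.
Implicit Types (S T : structure I) (C D : set (structure I)).

Definition is_module S (A : set S) : Prop :=
  forall (v : S) (i : I) (a a' : S), ~ A v -> A a -> A a' ->
    (related i v a -> related i v a') /\ (related i a v -> related i a' v).

Definition trivial_module S (A : set S) : Prop :=
  [\/ A = set0, exists x : S, A = [set x] | A = setT].

Definition prime_structure S : Prop :=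
  forall A : set S, is_module A -> trivial_module A.

Definition embedding S T (f : S -> T) : Prop :=
  injective f /\
  forall (i : I) (x y : S), related i x y <-> related i (f x) (f y).

Definition embeds S T : Prop := exists f : S -> T, embedding f.

Definition isomorphic S T : Prop :=
  exists f : S -> T, embedding f /\ bijective f.

Definition finite_structure S : Prop := finite_set [set: S].

Definition age S : set (structure I) :=
  [set T | finite_structure T /\ embeds T S].

Definition Prim C : set (structure I) := [set S | C S /\ prime_structure S].

Definition down_closure C : set (structure I) :=
  [set T | exists2 S, C S & embeds T S].

Definition hereditary C : Prop := forall S T, C S -> embeds T S -> C T.

(* The members of a class are counted up to isomorphism: a class closed under
   isomorphism is never literally finite unless it is empty. *)
Definition finitely_many C : Prop :=
  finite_set [set [set T | isomorphic S T] | S in C].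

Definition minimal_prime C : Prop :=
  [/\ C `<=` finite_structure, hereditary C, ~ finitely_many (Prim C)
    & forall D, hereditary D -> D `<` C -> finitely_many (Prim D)].

End Structures.

Section Orders.
Variable V : Type.
Implicit Types le : V -> V -> Prop.

Definition partial_order le : Prop := Relation_Definitions.order V le.

Definition linear_order le : Prop :=
  partial_order le /\ forall x y, le x y \/ le y x.

Definition poset le : structure unit := Structure (fun=> le).

Definition Inc le : structure unit :=
  Structure (fun _ x y => ~ le x y /\ ~ le y x).

Definition Comp le : structure unit :=
  Structure (fun _ x y => x <> y /\ (le x y \/ le y x)).

Definition bichain le1 le2 : structure bool :=
  Structure (fun i : bool => if i then le2 else le1).

Definition o_bichain le1 le2 : structure unit :=
  poset (fun x y => le1 x y /\ le2 x y).

End Orders.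

(* Main.v *)
(* For finite structures over finitely many relations, having finitely many
   members up to isomorphism means having bounded size; hence minimal primality
   passes along any construction [F] that keeps the carrier, commutes with
   embeddings, and preserves and reflects primality (complement of a graph,
   incomparability graph of a poset, intersection of the orders of a bichain).
   To come back from [F S] to [S] one needs moreover that [F S], when prime,
   determines [S] up to an involution (dual order, exchange of the two orders),
   and the involution is absorbed because ages are directed.

   The two facts on modules are due to Gallai.  A finite poset is prime iff its
   comparability graph is: either the vertices split into two completely joined
   parts, and a module of the poset is read off a minimal such part, or a maximal
   nontrivial module of the graph is a module of every transitive orientation,
   hence also of a bichain, whose orders are unions of orientations of the graph
   and of its complement.  A prime comparability graph has only two transitive
   orientations, dual to each other: the vertices of a forcing class of edges
   form a module, so every class spans all vertices. *)

From mathcomp Require Import all_boot.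
From mathcomp Require Import boolp classical_sets functions cardinality.
Require Import Defs.

Set Implicit Arguments.
Unset Strict Implicit.
Unset Printing Implicit Defensive.

Local Open Scope classical_set_scope.

(** * Embeddings and sizes *)

Section EmbeddingTheory.
Variable I : Type.
Implicit Types (S T U : structure I).

Lemma embedding_id S : @embedding I S S id.
Proof. by split. Qed.

Lemma embedding_comp S T U (f : S -> T) (g : T -> U) :
  embedding f -> embedding g -> embedding (g \o f).
Proof.
move=> [fI fR] [gI gR]; split; first exact: inj_comp.
by move=> i x y; rewrite fR gR.
Qed.

Lemma embeds_refl S : embeds S S.
Proof. by exists id; exact: embedding_id. Qed.

Lemma embeds_trans S T U : embeds S T -> embeds T U -> embeds S U.
Proof.
by move=> [f fE] [g gE]; exists (g \o f); exact: embedding_comp.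
Qed.

Definition induced T (X : Type) (g : X -> T) : structure I :=
  Structure (fun i (x y : X) => related i (g x) (g y)).

Lemma induced_embedding T X (g : X -> T) :
  injective g -> @embedding I (induced g) T g.
Proof. by split. Qed.

Lemma isomorphic_sym S T : isomorphic S T -> isomorphic T S.
Proof.
move=> [f [[_ fR] [g fK gK]]]; exists g; split; last by exists f.
by split=> [|i x y]; [exact: can_inj gK | rewrite fR !gK].
Qed.

Lemma isomorphic_trans S T U :
  isomorphic S T -> isomorphic T U -> isomorphic S U.
Proof.
move=> [f [fE fB]] [g [gE gB]]; exists (g \o f).
by split; [exact: embedding_comp | exact: bij_comp].
Qed.

Definition iso_class S : set (structure I) := [set T | isomorphic S T].

Lemma iso_class_eq S T : isomorphic S T -> iso_class S = iso_class T.
Proof.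
move=> ST; apply/seteqP; split=> U /=; last exact: isomorphic_trans.
exact/isomorphic_trans/isomorphic_sym.
Qed.

Lemma iso_class_inj S T : iso_class S = iso_class T -> isomorphic S T.
Proof.
move=> ST; suff : iso_class T T by rewrite -ST.
exists id; split; first exact: embedding_id.
by exists id.
Qed.

Definition size_le n S : Prop := exists f : S -> 'I_n, injective f.

Lemma size_leW m n S : m <= n -> size_le m S -> size_le n S.
Proof.
move=> mn [f fI]; exists (widen_ord mn \o f).
by apply: inj_comp => // x y /(congr1 val) /= /val_inj.
Qed.

Lemma size_le_embeds n S T : embeds S T -> size_le n T -> size_le n S.
Proof. by move=> [g [gI _]] [f fI]; exists (f \o g); exact: inj_comp. Qed.

Lemma finite_structureP S : finite_structure S <-> exists n, size_le n S.
Proof.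
split=> [[n /card_set_bijP[f [fS fI _]]]|[n [f fI]]].
  have fn x : f x < n by exact: fS.
  exists n, (fun x => Ordinal (fn x)) => x y [] /fI.
  by apply; rewrite in_setT.
apply: (@card_le_finite _ _ _ (range f)); last exact: finite_finset.
have : (range f #= [set: S])%card by apply: inj_card_eq => x y _ _ /fI.
by rewrite card_eq_le => /andP[].
Qed.

Lemma finite_embeds S T :
  embeds S T -> finite_structure T -> finite_structure S.
Proof.
move=> ST /finite_structureP[n Tn]; apply/finite_structureP; exists n.
exact: size_le_embeds Tn.
Qed.

(** [e] numbers the isomorphism classes below [k]. One size bound is chosen for each index, and the
    maximum of these bounds serves for all members. *)
Lemma finitely_many_bounded (C : set (structure I)) :
  C `<=` @finite_structure I -> finitely_many C ->
  exists n, forall S, C S -> size_le n S.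
Proof.
move=> Cfin [k /card_set_bijP[e [eS eI _]]].
have eC S : C S -> e (iso_class S) < k by move=> CS; apply: eS; exists S.
have : forall j, exists m, forall S, C S -> e (iso_class S) = j -> size_le m S.
  move=> j; have [[S [CS eSj]]|no] :=
    pselect (exists S, C S /\ e (iso_class S) = j).
    have /finite_structureP[m mS] := Cfin S CS; exists m => T CT eTj.
    apply: size_le_embeds mS.
    suff /iso_class_inj[f [? _]] : iso_class T = iso_class S by exists f.
    by apply: eI; rewrite ?inE ?eTj //; [exists T|exists S].
  (* An index that no class receives gets the dummy bound 0. *)
  by exists 0 => S CS eSj; case: no; exists S.
move=> /choice[m mP]; exists (\max_(j < k) m j) => S CS.
apply: size_leW (mP _ S CS erefl).
exact: (leq_bigmax (Ordinal (eC S CS))).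
Qed.

End EmbeddingTheory.

(** An injection into ['I_n] encodes a structure by its image and its transported relations. As [I]
    is finite there are finitely many codes, and a code determines the isomorphism class. *)
Lemma bounded_finitely_many (I : finType) (C : set (structure I)) n :
  (forall S, C S -> size_le n S) -> finitely_many C.
Proof.
move=> Cn.
pose code := ({set 'I_n} * {set I * 'I_n * 'I_n})%type.
(* The carriers of the decoded structures are types of natural numbers because
   the universe of ['I_n] lies above that of the carriers of structures. *)
pose decode (c : code) : structure I :=
  @Structure I {k : nat | k \in [seq val j | j in c.1]}
    (fun i x y => exists a b : 'I_n,
       [/\ val a = sval x, val b = sval y & (i, a, b) \in c.2]).
suff sub : @iso_class I @` C `<=` [set iso_class (decode c) | c in [set: code]].
  by apply: sub_finite_set sub _; exact: finite_image finite_finset.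
move=> _ [S CS <-]; have [f fI] := Cn S CS.
pose c : code := ([set k | `[< exists x, f x = k >]]%SET,
  [set p | `[< exists x y,
    [/\ f x = p.1.2, f y = p.2 & related p.1.1 x y] >]]%SET).
exists c => //; apply/esym/iso_class_eq.
have fc x : val (f x) \in [seq val j | j in c.1].
  by apply/mapP; exists (f x); rewrite // mem_enum inE; apply/asboolP; exists x.
exists (fun x => exist _ (val (f x)) (fc x)); split; first split.
- by move=> x y [] /val_inj/fI.
- move=> i x y /=; split=> [xy|].
    by exists (f x), (f y); split; rewrite // inE; apply/asboolP; exists x, y.
  move=> [a [b [/val_inj -> /val_inj -> ]]]; rewrite inE.
  by move=> /asboolP[x' [y' [/fI -> /fI ->]]].
- rewrite -setTT_bijective; split=> [//|x y _ _ [] /val_inj/fI //|[k kc] _].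
  have /mapP[j] := kc; rewrite mem_enum inE => /asboolP[x xj] kj.
  by exists x => //; apply: val_inj; rewrite /= kj -xj.
Qed.

Definition bounded (I : Type) (C : set (structure I)) : Prop :=
  exists n, forall S, C S -> size_le n S.

Lemma finitely_manyP (I : finType) (C : set (structure I)) :
  C `<=` @finite_structure I -> finitely_many C <-> bounded C.
Proof.
move=> Cfin; split; first exact: finitely_many_bounded.
by move=> [n]; exact: bounded_finitely_many.
Qed.

(** * Minimal prime ages *)

Section MinimalPrime.
Variable I : finType.
Implicit Types (S T : structure I) (C D : set (structure I)).

Lemma age_hereditary S : hereditary (age S).
Proof.
move=> T U [Tfin TS] UT; split; first exact: finite_embeds Tfin.
exact: embeds_trans TS.
Qed.

Lemma sub_Prim_finite C :
  C `<=` @finite_structure I -> Prim C `<=` @finite_structure I.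
Proof. by move=> Cfin S [/Cfin]. Qed.

(** The working form of minimality: counting becomes bounding sizes, and the condition on proper
    subclasses is contraposed. *)
Lemma minimal_prime_ageP S : minimal_prime (age S) <->
  ~ bounded (Prim (age S)) /\
  forall D, hereditary D -> D `<=` age S -> ~ bounded (Prim D) -> age S `<=` D.
Proof.
have agefin : age S `<=` @finite_structure I by move=> T [].
have primP D : D `<=` age S -> finitely_many (Prim D) <-> bounded (Prim D).
  by move=> DS; apply/finitely_manyP/sub_Prim_finite => T /DS/agefin.
split=> [[_ _ inf min]|[inf min]].
  split=> [bd|D hD DS ub]; first exact/inf/(primP _ (@subset_refl _ _)).
  by apply: contrapT => SD; apply: ub; apply/primP/min.
split=> //; first exact: age_hereditary.
- by move=> /(primP _ (@subset_refl _ _)).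
- by move=> D hD [DS SD]; apply/primP => //; apply: contrapT => /(min _ hD DS).
Qed.

(** Ages are directed: the union of the two finite images inside [S] induces a common extension. *)
Lemma age_joint S T U : age S T -> age S U ->
  exists W, [/\ age S W, embeds T W & embeds U W].
Proof.
move=> [Tfin [f [fI fR]]] [Ufin [g [gI gR]]].
pose A := range f `|` range g; pose W := @induced I S {x | A x} sval.
have svalI : injective (@sval S A) 
    by move=> [x Ax] [y Ay] /= xy; subst y; congr exist; exact: Prop_irrelevance.
exists W; split.
- split; last by exists sval; exact: induced_embedding.
  have : finite_set A by rewrite finite_setU; split; exact: finite_image.
  apply: card_le_finite; have : (range (@sval S A) #= [set: W])%card.
    by apply: inj_card_eq => x y _ _ /svalI.
  rewrite card_eq_le => /andP[_] /card_le_trans; apply.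
  by apply: subset_card_le => _ [[x Ax] _ <-].
- have fA x : A (f x) by left; exists x.
  exists (fun x => exist _ (f x) (fA x)); split=> [x y [] /fI //|i x y].
  exact: fR.
- have gA x : A (g x) by right; exists x.
  exists (fun x => exist _ (g x) (gA x)); split=> [x y [] /gI //|i x y].
  exact: gR.
Qed.

End MinimalPrime.

(** * Transfer of minimal primality along a carrier-preserving construction *)

Section Transfer.
Variables (I J : finType) (r : forall S : structure I, J -> S -> S -> Prop).
Local Notation F := (fun S : structure I => Structure (@r S)).
Hypothesis F_embedding : forall (S T : structure I) (f : S -> T),
  embedding f -> @embedding J (F S) (F T) f.
Variable K : set (structure I).
Implicit Types (S T U : structure I).
Hypothesis K_hereditary : hereditary K.
Hypothesis prime_F : forall S, K S -> finite_structure S ->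
  prime_structure S <-> prime_structure (F S).

Lemma F_embeds S T : embeds S T -> embeds (F S) (F T).
Proof. by move=> [f /F_embedding]; exists f. Qed.

(** The relations of [T] are pulled back along the embedding. The result lives on the carrier of [G]
    itself, so that [F_unique], which compares two structures on one carrier, can be applied to
    it. *)
Lemma embeds_F_induced (G : structure J) T : embeds G (F T) ->
  exists s : I -> G -> G -> Prop,
    embeds (Structure s) T /\ @related J G = r (S := Structure s).
Proof.
move=> [g [gI gR]]; exists (fun i x y => @related I T i (g x) (g y)).
set S := Structure _; have gE : @embedding I S T g by split.
split; first by exists g.
apply: funext => j; apply: funext => x; apply: funext => y; apply: propext.
by rewrite gR; exact: iff_sym ((F_embedding gE).2 j x y).
Qed.

Lemma embeds_F (G : structure J) T : embeds G (F T) ->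
  exists2 S, embeds S T & G = F S.
Proof.
by case: G => X g /embeds_F_induced[s [sT /= ->]]; exists (Structure s).
Qed.

Lemma minimal_prime_F S :
  K S -> minimal_prime (age S) -> minimal_prime (age (F S)).
Proof.
move=> KS; rewrite !minimal_prime_ageP => -[inf min]; split.
  move=> [n bd]; apply: inf; exists n => T [[Tfin TS] Tprime].
  apply: (bd (F T)); split; first by split=> //; exact: F_embeds.
  by apply/prime_F => //; exact: K_hereditary TS.
move=> D hD DS ub G [Gfin GS]; have [T TS GE] := embeds_F GS.
rewrite GE in Gfin *.
(* The preimage of [D] under [F] within [age S] is hereditary and inherits unbounded primes from
   [D], so minimality applies to it. *)
pose D' : set (structure I) := [set U | age S U /\ D (F U)].
suff : age S `<=` D' by move=> /(_ T)[].
apply: min.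
- move=> U W [SU DU] WU; split; first exact: age_hereditary WU.
  exact/(hD _ _ DU)/F_embeds.
- by move=> U [].
- move=> [n bd]; apply: ub; exists n => H [DH Hprime].
  have [Hfin /embeds_F[U US HE]] := DS H DH; subst H.
  apply: (bd U); split; first by [].
  by apply/prime_F => //; exact: K_hereditary US.
Qed.

(** The down-closure is a hereditary subclass of the age with the same primes, hence the whole
    age. *)
Lemma minimal_prime_down_closure S :
  minimal_prime (age S) -> down_closure (Prim (age S)) = age S.
Proof.
rewrite minimal_prime_ageP => -[inf min].
have sub : down_closure (Prim (age S)) `<=` age S.
  by move=> T [U [SU _]]; exact: age_hereditary.
apply/seteqP; split=> //; apply: min => //.
  by move=> T U [W SW TW] UT; exists W => //; exact: embeds_trans TW.
move=> [n bd]; apply: inf; exists n => T [ST Tprime]; apply: bd.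
by split=> //; exists T => //; exact: embeds_refl.
Qed.

(** [t] stands for the involution on structures: order duality for posets, exchange of the two
    orders for bichains. *)
Variable t : forall S : structure I, I -> S -> S -> Prop.
Local Notation "S ^t" := (Structure (@t S)) (at level 2, format "S ^t").
Hypothesis t_embedding : forall (S T : structure I) (f : S -> T),
  embedding f -> @embedding I S^t T^t f.
Hypothesis tK : forall S : structure I, embeds S S^t^t.
Hypothesis F_unique : forall X (s u : I -> X -> X -> Prop),
  let S := Structure s in let U := Structure u in
  K S -> K U -> finite_structure S -> prime_structure (F S) ->
  r (S := S) = r (S := U) -> embeds S U \/ embeds S^t U.

(* A proper hereditary subclass [D] of [age S] with unboundedly many primes
   contains every prime member of [age S] up to [^t]; as [age S] is directed, a
   single member outside [D] forces [D] to be closed under [^t]. *)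
Lemma minimal_prime_F_down_closure S : K S ->
  minimal_prime (age (F S)) -> down_closure (Prim (age S)) = age S ->
  minimal_prime (age S).
Proof.
move=> KS; rewrite !minimal_prime_ageP => -[inf min] dS.
have KD T : age S T -> K T by move=> [_]; exact: K_hereditary.
split.
  move=> [n bd]; apply: inf; exists n => G [[Gfin /embeds_F[T TS GE]] Gprime].
  subst G; apply: (bd T); split; first by [].
  by apply/prime_F => //; exact: K_hereditary TS.
(* The downward closure of the image of [D] under [F] has unbounded primes, so by minimality it is
   all of [age (F S)]. *)
move=> D hD DS ub; pose D' : set (structure J) :=
  [set G | exists2 T, D T & embeds G (F T)].
have FD T : age S T -> D' (F T).
  move=> ST; have: age (F S) `<=` D'; last first.
    by apply; have [? ?] := ST; split=> //; exact: F_embeds.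
  apply: min.
  - by move=> G H [U DU GU] HG; exists U => //; exact: embeds_trans GU.
  - move=> G [U /DS[Ufin US] GU]; split; first exact: finite_embeds GU _.
    exact/(embeds_trans GU)/F_embeds.
  - move=> [n bd]; apply: ub; exists n => U [DU Uprime].
    have SU := DS U DU; apply: (bd (F U)); split.
      by exists U => //; exact: embeds_refl.
    by apply/prime_F => //; [exact: KD | case: SU].
have prime_D T : age S T -> prime_structure T -> D T \/ D T^t.
  case: T => X s ST Tprime; have [U DU] := FD _ ST.
  move=> /embeds_F_induced[u [uU ru]].
  have Du : D (Structure u) by exact: hD uU.
  have [] := F_unique (KD _ ST) (KD _ (DS _ Du)) ST.1 _ ru.
  - by apply/prime_F => //; [exact: KD | exact: ST.1].
  - by move=> /(hD _ _ Du); left.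
  - by move=> /(hD _ _ Du); right.
have t_embeds T U : embeds T U -> embeds T^t U^t.
  by move=> [f /t_embedding]; exists f.
move=> R SR; apply: contrapT => nDR.
(* [Q] and the missing member [R] lie in a common prime [Z] of the age. Since [R] keeps [Z] out of
   [D], the structure [Z^t] is in [D], and so are [Q^t] and [R^t]. *)
have sup Q : age S Q -> D Q^t /\ D R^t.
  move=> SQ; have [W [SW RW QW]] := age_joint SR SQ.
  have [Z [SZ Zprime] WZ] : down_closure (Prim (age S)) W by rewrite dS.
  have nDZ : ~ D Z by move=> /hD DZ; exact/nDR/DZ/(embeds_trans RW).
  have [//|DZ] := prime_D Z SZ Zprime.
  by split; apply: hD DZ _; apply: t_embeds;
    [exact: embeds_trans QW WZ | exact: embeds_trans RW WZ].
(* Taking [R^t] for [Q] puts [R^t^t], and with it [R], into [D]. *)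
have DRt := (sup R SR).2.
by apply/nDR/(hD _ _ (sup _ (DS _ DRt)).1)/tK.
Qed.

Lemma minimal_prime_F_iff S : K S ->
  minimal_prime (age S) <->
  minimal_prime (age (F S)) /\ down_closure (Prim (age S)) = age S.
Proof.
move=> KS; split; last by case; exact: minimal_prime_F_down_closure.
by move=> mS; split; [exact: minimal_prime_F |
  exact: minimal_prime_down_closure].
Qed.

End Transfer.

(** * Modules of posets and comparability graphs *)

Section Modules.
Variable V : Type.
Implicit Types (A X : set V) (le : V -> V -> Prop).

Definition nontrivial A : Prop :=
  (exists a b, [/\ A a, A b & a <> b]) /\ exists c, ~ A c.

Lemma nontrivialP (I : Type) (r : I -> V -> V -> Prop) A :
  nontrivial A <-> ~ @trivial_module I (Structure r) A.
Proof.
split=> [[[a [b [Aa Ab ab]]] [c Ac]] [A0|[x Ax]|AT]|nA].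
- by rewrite A0 in Aa.
- by apply: ab; move: Aa Ab; rewrite Ax => -> ->.
- by apply: Ac; rewrite AT.
have [a Aa] : exists a, A a.
  apply: contrapT => A0; apply: nA; constructor 1; apply/seteqP.
  by split=> // x Ax; apply: A0; exists x.
split.
  apply: contrapT => A1; apply: nA; constructor 2; exists a; apply/seteqP.
  split=> [x Ax|x -> //] /=; apply: contrapT => xa; apply: A1.
  by exists x, a.
apply: contrapT => AT; apply: nA; constructor 3; apply/seteqP.
by split=> // x _; apply: contrapT => Ax; apply: AT; exists x.
Qed.

Lemma prime_structureP (I : Type) (r : I -> V -> V -> Prop) :
  prime_structure (Structure r) <->
  forall A, @is_module I (Structure r) A -> ~ nontrivial A.
Proof.
split=> [pr A /pr tA /(nontrivialP r)//|pr A /pr nA].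
by apply: contrapT => /nontrivialP.
Qed.

Lemma exists_maximal (P : set V -> Prop) A :
  finite_set [set: V] -> P A ->
  exists2 B, P B & forall C, P C -> B `<=` C -> C `<=` B.
Proof.
(* A structure without relations serves to turn finiteness of [V] into an injection to some ['I_n],
   where cardinals of images can be maximised. *)
move=> /(finite_structureP (@Structure void V (fun=> fun=> fun=> False))).
move=> [n [f fI]] PA.
pose im A := [set i | `[< exists2 a, A a & f a = i >]]%SET.
have imP B x : f x \in im B <-> B x.
  by rewrite inE; split=> [/asboolP[a Ba /fI <-]|Bx] //; apply/asboolP; exists x.
have ex : exists k, `[< exists2 B, P B & #|im B| = k >].
  by exists #|im A|; apply/asboolP; exists A.
have bd k : `[< exists2 B, P B & #|im B| = k >] -> k <= n.
  by move=> /asboolP[B _ <-]; rewrite -[n in _ <= n]card_ord max_card.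
case: (ex_maxnP ex bd) => k /asboolP[B PB <-] kmax.
exists B => // C PC BC x Cx.
have sub : im B \subset im C.
  apply/fintype.subsetP => i; rewrite inE => /asboolP[a Ba <-].
  exact/imP/BC.
have /eqP : im B == im C.
  by rewrite eqEcard sub kmax //; apply/asboolP; exists C.
by move=> imBC; apply/imP; rewrite imBC; apply/imP.
Qed.

Definition comparable le x y : Prop := le x y \/ le y x.

Lemma comparable_sym le x y : comparable le x y -> comparable le y x.
Proof. by case; [right|left]. Qed.

(** Equivalently, [A] is a union of connected components of the incomparability graph. *)
Definition joined le A : Prop :=
  forall x y, A x -> ~ A y -> comparable le x y.

Lemma is_module_CompP le A : is_module (S := Comp le) A <->
  forall v a a', ~ A v -> A a -> A a' ->
    comparable le v a -> comparable le v a'.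
Proof.
split=> mA v.
  move=> a a' Av Aa Aa' va; have [] := mA v tt a a' Av Aa Aa' => /= + _.
  by case=> //; split=> // vE; apply: Av; rewrite vE.
have av a : ~ A v -> A a -> v <> a by move=> Av Aa vE; apply: Av; rewrite vE.
move=> [] a a' Av Aa Aa'; split=> /= -[_ va].
  by split; [exact: av | exact: mA va].
split; first by move/esym; exact: av.
by apply/comparable_sym/(mA v a)=> //; exact: comparable_sym.
Qed.

Lemma is_module_poset_Comp le A :
  is_module (S := poset le) A -> is_module (S := Comp le) A.
Proof.
move=> mA; apply/is_module_CompP => v a a' Av Aa Aa'.
have [va av] := mA v tt a a' Av Aa Aa'.
by case=> [/va|/av]; [left|right].
Qed.

(** A minimal nonempty proper joined set [X] is a module. If it is a single vertex [x0], then [x0]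
    is comparable to everything, and either its down-set or its complement serves. The nontrivial
    set in the hypotheses guarantees three vertices. *)
Lemma joined_module le : finite_set [set: V] -> partial_order le ->
  (exists A, nontrivial A) ->
  (exists X, [/\ exists x, X x, exists y, ~ X y & joined le X]) ->
  exists A, [/\ nontrivial A, is_module (S := poset le) A & joined le A].
Proof.
move=> Vfin [refl trans anti] [A0 [[a [b [A0a A0b ab]]] [c A0c]]] [X0 X0P].
pose split X := [/\ exists x, X x, exists y, ~ X y & joined le X].
have sX0 : split (~` ~` X0) by rewrite setCK.
have [Y] := @exists_maximal (fun Y => split (~` Y)) _ Vfin sX0.
set X := ~` Y => -[[x0 Xx0] [y0 Xy0] Xj] Ymax.
have Xmin X1 : split X1 -> X1 `<=` X -> X `<=` X1.
  move=> sX1 X1X z Xz; apply: contrapT => X1z; apply: Xz.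
  apply: (Ymax (~` X1)) => //.
    by rewrite setCK.
  by move=> y Yy X1y; exact: X1X X1y Yy.
(* The elements of [X] below [v] form a joined set: the other elements of [X] are above [v], hence
   above all of these. Minimality makes this set the whole of [X]. *)
have below v x x' : ~ X v -> X x -> X x' -> le x v -> le x' v.
  move=> Xv Xx Xx' xv.
  suff : X `<=` [set z | X z /\ le z v] by move=> /(_ _ Xx')[].
  apply: Xmin => [|z []//]; split; first by exists x.
    by exists y0 => -[].
  move=> z y [Xz zv] nXy; have [Xy|{}nXy] := pselect (X y); last exact: Xj.
  left; apply: trans zv _; have [] // := Xj y v Xy Xv.
  by move=> yv; case: nXy.
have mX : is_module (S := poset le) X.
  move=> v [] x x' Xv Xx Xx'; split=> /= [vx|]; last exact: below.
  have [x'v|//] := Xj x' v Xx' Xv.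
  have xv := below v x' x Xv Xx' Xx x'v.
  by case: Xv; rewrite (anti _ _ vx xv).
have [[x1 [Xx1 x01]]|X1] := pselect (exists x1, X x1 /\ x0 <> x1).
  by exists X; split=> //; split; [exists x0, x1 | exists y0].
have Xx x : X x -> x = x0.
  by move=> Xx; apply: contrapT => xx0; apply: X1; exists x; split=> // /esym.
have x0P x : comparable le x0 x.
  have [/Xx ->|/(Xj x0 x Xx0) //] := pselect (X x); by left.
have x0j A : (forall x, A x <-> x <> x0) -> joined le A.
  move=> AP x y /AP _ nAy; have -> : y = x0 by apply: contrapT => /AP.
  exact/comparable_sym.
have nt : nontrivial [set x | x <> x0].
  split; last by exists x0; apply.
  have [ax|ax] := pselect (a = x0); have [bx|bx] := pselect (b = x0).
  - by case: ab; rewrite ax bx.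
  - exists b, c; split=> //= [cx|bc]; last by apply: A0c; rewrite -bc.
    by apply: A0c; rewrite cx -ax.
  - exists a, c; split=> //= [cx|ac]; last by apply: A0c; rewrite -ac.
    by apply: A0c; rewrite cx -bx.
  - by exists a, b.
pose D := [set y | le y x0].
have jD : joined le D.
  move=> d u Dd Du; left; apply: trans Dd _; have [//|/Du] := x0P u.
  by [].
have [[d [Dd dx0]]|D0] := pselect (exists d, D d /\ d <> x0).
  have [[u Du]|DT] := pselect (exists u, ~ D u).
    exists D; split=> //.
      by split; [exists d, x0; split=> //; exact: refl | exists u].
    move=> v [] z z' Dv Dz Dz'; split=> /= [vz|zv].
      by case: Dv; exact: trans vz Dz.
    have [x0v|//] := x0P v; exact: trans Dz' x0v.
  (* Here [x0] is the greatest element; in the remaining case below it is the least. *)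
  exists [set x | x <> x0]; split=> //; last exact: x0j.
  have Dall z : le z x0 by apply: contrapT => Dz; apply: DT; exists z.
  move=> v [] z z' /contrapT -> zx0 z'x0; split=> [/= x0z|_]; last exact: Dall.
  by case: zx0; exact: anti.
exists [set x | x <> x0]; split=> //; last exact: x0j.
have up z : le x0 z.
  have [//|zx0] := x0P z; suff -> : z = x0 by exact: refl.
  by apply: contrapT => ?; apply: D0; exists z.
move=> v [] z z' /contrapT -> zx0 z'x0; split=> /= [_|zx]; first exact: up.
by case: zx0; exact: anti.
Qed.

(* Adding to [A] the outside vertices lying both above and below elements of
   [A] yields a module of the comparability graph. *)
Lemma maximal_module le A : partial_order le ->
  is_module (S := Comp le) A -> nontrivial A ->
  (forall B, is_module (S := Comp le) B -> nontrivial B ->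
    A `<=` B -> B `<=` A) ->
  ~ joined le A -> is_module (S := poset le) A.
Proof.
move=> [refl trans anti] /is_module_CompP mA [A2 [c Ac]] Amax nj.
pose X := [set v | ~ A v /\ exists a a', [/\ A a, A a', le a v & le v a']].
(* If [u] is comparable to [A] but not to [v], then [u <= a1] and [a2 <= u] are both excluded by
   transitivity through [v], so [a1 <= u <= a2] puts [u] in [X]. *)
have XA u v a : ~ A u -> ~ X u -> X v -> A a ->
    comparable le u a <-> comparable le u v.
  move=> Au Xu [Av [a1 [a2 [Aa1 Aa2 a1v va2]]]] Aa; split=> [ua|].
    apply: contrapT => nuv; apply: Xu; split=> //; exists a1, a2; split=> //.
    + have [ua1|//] := mA u a a1 Au Aa Aa1 ua.
      by case: nuv; left; exact: trans ua1 a1v.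
    + have [//|a2u] := mA u a a2 Au Aa Aa2 ua.
      by case: nuv; right; exact: trans va2 a2u.
  move=> [uv|vu].
    by apply: (mA u a2 a) => //; left; exact: trans uv va2.
  by apply: (mA u a1 a) => //; right; exact: trans a1v vu.
have [a0 Aa0] : exists a, A a by have [a [_ [Aa _ _]]] := A2; exists a.
have mAX : is_module (S := Comp le) (A `|` X).
  have aE u w : ~ (A `|` X) u -> (A `|` X) w ->
      comparable le u a0 <-> comparable le u w.
    move=> /not_orP[Au Xu] [Aw|Xw]; last exact: XA.
    by split; apply: mA.
  by apply/is_module_CompP => u w w' uAX wAX w'AX /aE /aE; apply.
(* If [A] and [X] do not cover [V], maximality of [A] empties [X]. If they do, every outside vertex
   is comparable to all of [A], making [A] joined. *)
have X0 v : ~ X v.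
  have [[u uAX]|AXT] := pselect (exists u, ~ (A `|` X) u).
    move=> Xv; have [Av _] := Xv; apply: Av; apply: (Amax (A `|` X)) => //.
    - split; last by exists u.
      by have [a [b [Aa Ab ab]]] := A2; exists a, b; split=> //; left.
    - by right.
  case: nj => x y Ax Ay; have [//|Xy] : (A `|` X) y.
    by apply: contrapT => nAX; apply: AXT; exists y.
  have [_ [a1 [_ [Aa1 _ a1y _]]]] := Xy.
  by apply/comparable_sym/(mA y a1) => //; right.
move=> v [] a a' Av Aa Aa'; split=> /= le_av.
  have [//|a'v] := mA v a a' Av Aa Aa' (or_introl le_av).
  by case: (X0 v); split=> //; exists a', a.
have [va'|//] := mA v a a' Av Aa Aa' (or_intror le_av).
by case: (X0 v); split=> //; exists a, a'.
Qed.

Lemma prime_poset_Comp le : finite_set [set: V] -> partial_order le ->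
  prime_structure (poset le) <-> prime_structure (Comp le).
Proof.
move=> Vfin ole; split=> /prime_structureP pr; apply/prime_structureP => A.
  move=> mA ntA; have [sp|nsp] := pselect
    (exists X, [/\ exists x, X x, exists y, ~ X y & joined le X]).
    have [B [ntB mB _]] := joined_module Vfin ole (ex_intro _ A ntA) sp.
    exact: (pr B mB ntB).
  have [B [mB ntB] Bmax] := @exists_maximal
    (fun B => is_module (S := Comp le) B /\ nontrivial B) A Vfin (conj mA ntA).
  apply: (pr B _ ntB); apply: maximal_module => //.
    by move=> C mC ntC; exact: Bmax.
  move=> jB; apply: nsp; exists B; have [[b [_ [Bb _ _]]] nB] := ntB.
  by split=> //; exists b.
by move=> /is_module_poset_Comp; exact: pr.
Qed.

End Modules.

(** * Modules of bichains *)

Section Bichains.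
Variable V : Type.
Implicit Types (A : set V) (le : V -> V -> Prop).

Definition complementary le le' : Prop :=
  forall x y, x <> y -> comparable le' x y <-> ~ comparable le x y.

Lemma complementary_sym le le' : complementary le le' -> complementary le' le.
Proof.
move=> cle x y xy; split=> [? /cle|ncle]; first by apply.
by apply: contrapT => /(cle x y xy).
Qed.

Lemma complementary_is_module le le' A : complementary le le' ->
  is_module (S := Comp le) A -> is_module (S := Comp le') A.
Proof.
move=> cle /is_module_CompP mA; apply/is_module_CompP => v a a' Av Aa Aa'.
have av b : A b -> v <> b by move=> Ab vE; apply: Av; rewrite vE.
move=> /(cle _ _ (av a Aa)) nva; apply/(cle _ _ (av a' Aa')) => va'.
exact/nva/(mA v a' a).
Qed.

Lemma complementary_prime_Comp le le' : complementary le le' ->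
  prime_structure (Comp le) -> prime_structure (Comp le').
Proof.
move=> cle pr A mA; apply: pr.
exact: complementary_is_module (complementary_sym cle) mA.
Qed.

Lemma complementary_joined le le' A : complementary le le' ->
  joined le A -> is_module (S := poset le') A.
Proof.
move=> cle jA v [] a a' Av Aa Aa'.
have nav : ~ comparable le' a v.
  move=> /cle; apply; last exact: jA.
  by move=> avE; apply: Av; rewrite -avE.
by split=> /= ?; case: nav; [right|left].
Qed.

Variables le1 le2 : V -> V -> Prop.
Hypotheses (lin1 : linear_order le1) (lin2 : linear_order le2).

Let meet x y := le1 x y /\ le2 x y.
(** The order [skew] transitively orients the incomparability graph of [meet]; [le1] is the union of
    [meet] and [skew], and [le2] that of [meet] and the dual of [skew]. *)
Let skew x y := le1 x y /\ le2 y x.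

Lemma partial_order_meet : partial_order meet.
Proof.
have [[refl1 trans1 anti1] _] := lin1; have [[refl2 trans2 anti2] _] := lin2.
split=> [x|x y z [xy1 xy2] [yz1 yz2]|x y [xy _] [yx _]]; first by split.
  by split; [exact: trans1 yz1 | exact: trans2 yz2].
exact: anti1.
Qed.

Lemma partial_order_skew : partial_order skew.
Proof.
have [[refl1 trans1 anti1] _] := lin1; have [[refl2 trans2 anti2] _] := lin2.
split=> [x|x y z [xy1 xy2] [yz1 yz2]|x y [xy _] [yx _]]; first by split.
  by split; [exact: trans1 yz1 | exact: trans2 xy2].
exact: anti1.
Qed.

Lemma complementary_meet_skew : complementary meet skew.
Proof.
have [[refl1 trans1 anti1] tot1] := lin1.
have [[refl2 trans2 anti2] tot2] := lin2.
move=> x y xy; split=> [|nm].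
  by move=> [] [? ?] [] [? ?]; apply: xy; by [exact: anti1 | exact: anti2].
case: (tot1 x y) (tot2 x y) => xy1 [] xy2; last 1 first.
- by case: nm; right.
- by case: nm; left.
- by left.
- by right.
Qed.

Lemma related_meet_skew x y :
  (le1 x y <-> meet x y \/ skew x y) /\ (le2 x y <-> meet x y \/ skew y x).
Proof.
have [_ tot1] := lin1; have [_ tot2] := lin2.
split; split=> [xy|[] []//].
- by case: (tot2 x y); [left|right].
- by case: (tot1 x y); [left|right].
Qed.

Lemma prime_bichain_o : finite_set [set: V] ->
  prime_structure (bichain le1 le2) <-> prime_structure (o_bichain le1 le2).
Proof.
move=> Vfin; split=> /prime_structureP pr; apply/prime_structureP => A; last first.
  move=> mA; apply: pr => v [] a a' Av Aa Aa'.
  have /= [va1 av1] := mA v false a a' Av Aa Aa'.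
  have /= [va2 av2] := mA v true a a' Av Aa Aa'.
  by split=> /= -[]; [move=> /va1 ? /va2 | move=> /av1 ? /av2].
(* Both orders are unions of [meet] with [skew] or its dual, so a common module of [meet] and [skew]
   is a module of the bichain. It remains to produce a nontrivial one. *)
have join B : is_module (S := poset meet) B -> is_module (S := poset skew) B ->
    ~ nontrivial B.
  move=> mB sB; apply: pr => v i a a' Bv Ba Ba'.
  have /= [mva mav] := mB v tt a a' Bv Ba Ba'.
  have /= [sva sav] := sB v tt a a' Bv Ba Ba'.
  have [va1 va2] := related_meet_skew v a.
  have [av1 av2] := related_meet_skew a v.
  have [va1' va2'] := related_meet_skew v a'.
  have [av1' av2'] := related_meet_skew a' v.
  case: i; split=> /=.
  - by move=> /va2[/mva|/sav] ?; apply/va2'; [left|right].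
  - by move=> /av2[/mav|/sva] ?; apply/av2'; [left|right].
  - by move=> /va1[/mva|/sva] ?; apply/va1'; [left|right].
  - by move=> /av1[/mav|/sav] ?; apply/av1'; [left|right].
have om := partial_order_meet; have os := partial_order_skew.
have cms := complementary_meet_skew; have csm := complementary_sym cms.
move=> /is_module_poset_Comp mA ntA.
have exA : exists A, nontrivial A by exists A.
have [sp|nspm] := pselect
    (exists X, [/\ exists x, X x, exists y, ~ X y & joined meet X]).
  have [B [ntB mB jB]] := joined_module Vfin om exA sp.
  exact: join (complementary_joined cms jB) ntB.
have [sp|nsps] := pselect
    (exists X, [/\ exists x, X x, exists y, ~ X y & joined skew X]).
  have [B [ntB mB jB]] := joined_module Vfin os exA sp.
  by apply: join ntB => //; exact: complementary_joined csm jB.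
(* Complementary graphs have the same modules, so a maximal one for [meet] is also maximal for
   [skew], and [maximal_module] applies to both orders. *)
have [B [mB ntB] Bmax] := @exists_maximal V
  (fun B => is_module (S := Comp meet) B /\ nontrivial B) A Vfin (conj mA ntA).
have [[b [_ [Bb _ _]]] nB] := ntB.
apply: (join B _ _ ntB); apply: maximal_module => //.
- by move=> C mC ntC; exact: Bmax.
- by move=> jB; apply: nspm; exists B; split=> //; exists b.
- exact: complementary_is_module mB.
- by move=> C mC ntC; apply: Bmax; split=> //;
    exact: complementary_is_module mC.
- by move=> jB; apply: nsps; exists B; split=> //; exists b.
Qed.

End Bichains.

(** * Transitive orientations of prime graphs *)

Section Orientations.
Variable V : Type.
Implicit Types le : V -> V -> Prop.

(** Gallai's forcing: when [x y] and [x z] are edges and [y z] is not, a transitive orientation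
    directs both out of [x] or both into [x]. This is the forcing class of the edge [b c], with each
    edge taken in both directions. *)
Inductive forced (adj : V -> V -> Prop) (b c : V) : V -> V -> Prop :=
| forced_refl : forced adj b c b c
| forced_sym x y : forced adj b c x y -> forced adj b c y x
| forced_step x y z :
    forced adj b c x y -> adj x z -> ~ adj y z -> forced adj b c x z.

(** A vertex [v] outside the class that is adjacent to one end of a class edge is adjacent to the
    other, since otherwise the edge to [v] would be forced. So adjacency to [v] is constant on the
    class, whose vertices form a module. *)
Lemma forced_spanning le b c :
  prime_structure (Comp le) -> b <> c -> comparable le b c ->
  forall x, exists y, forced (comparable le) b c x y.
Proof.
move=> /prime_structureP pr bc cbc.
pose W := [set x | exists y, forced (comparable le) b c x y].
have Wb : W b by exists c; exact: forced_refl.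
have Wc : W c by exists b; apply: forced_sym; exact: forced_refl.
suff mW : is_module (S := Comp le) W.
  move=> x; apply: contrapT => Wx; apply: (pr _ mW).
  by split; [exists b, c | exists x].
apply/is_module_CompP => v a a' Wv.
have same x y : forced (comparable le) b c x y ->
    comparable le v x <-> comparable le v y.
  move=> xy; split=> [vx|vy]; apply: contrapT => nv; apply: Wv.
    exists x; apply: forced_sym; apply: (forced_step xy).
      exact: comparable_sym.
    by move=> yv; apply: nv; exact: comparable_sym.
  exists y; apply: forced_sym; apply: (forced_step (forced_sym xy)).
    exact: comparable_sym.
  by move=> xv; apply: nv; exact: comparable_sym.
have toB x y : forced (comparable le) b c x y ->
    comparable le v x <-> comparable le v b.
  move=> f; suff [] : (comparable le v x <-> comparable le v b) /\
      (comparable le v y <-> comparable le v b) by [].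
  elim: f => {x y} [|x y _ [] //|x y z f [xb _] xz yz].
    by split=> //; apply: iff_sym; apply: same; exact: forced_refl.
  split=> //; rewrite -xb; apply: iff_sym; apply: same.
  exact: forced_step f xz yz.
by move=> [y /toB aE] [y' /toB a'E] /aE /a'E.
Qed.

(** Disagreement on an edge is written as agreement with [converse le'], so each lemma covers both
    notions. *)
Definition agree le le' x y : Prop :=
  x <> y /\ (le x y /\ le' x y \/ le y x /\ le' y x).

Definition compatible le le' : Prop :=
  [/\ partial_order le, partial_order le' &
    forall x y, comparable le x y <-> comparable le' x y].

Definition converse le x y : Prop := le y x.

Lemma compatible_converse le le' :
  compatible le le' -> compatible le (converse le').
Proof.
move=> [ole [refl trans anti] cle]; split=> //.
  split=> [x|x y z yx zy|x y yx xy]; first exact: refl.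
    exact: trans zy yx.
  exact: anti.
by move=> x y; rewrite cle; split=> xy; exact: comparable_sym xy.
Qed.

Lemma agree_sym le le' x y : agree le le' x y -> agree le le' y x.
Proof. by move=> [xy [[]|[]]]; split; auto. Qed.

Lemma agree_comparable le le' x y : agree le le' x y -> comparable le x y.
Proof. by move=> [_ [[]|[]]]; [left|right]. Qed.

Lemma agree_or le le' x y : compatible le le' -> x <> y -> comparable le x y ->
  agree le le' x y \/ agree le (converse le') x y.
Proof.
move=> [_ _ cle] xy cxy; have /cle := cxy; rewrite /agree /converse.
by case: cxy => ? [] ?; auto 6.
Qed.

Lemma agree_converse le le' x y :
  compatible le le' -> agree le le' x y -> ~ agree le (converse le') x y.
Proof.
move=> [[_ _ anti] [_ _ anti'] _] [xy H] [_]; rewrite /converse => H'.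
by apply: xy; case: H H' => [] [? ?] [] [? ?]; auto.
Qed.

(** With one edge agreeing and the next disagreeing, the path [x y z] is directed in exactly one of
    the two orders, and transitivity there closes it. *)
Lemma agree_triangle le le' x y z : compatible le le' ->
  agree le le' x y -> agree le (converse le') y z -> comparable le x z.
Proof.
move=> [[_ trans _] [_ trans' _] cle] [_ xy] [_]; rewrite /converse => yz.
case: xy yz => [] [xy xy'] [] [yz yz'].
- by left; exact: trans yz.
- by apply/cle; left; exact: trans' yz'.
- by apply/cle; right; exact: trans' xy'.
- by right; exact: trans xy.
Qed.

Lemma agree_step le le' x y z : compatible le le' -> agree le le' x y ->
  comparable le x z -> ~ comparable le y z -> agree le le' x z.
Proof.
move=> [[_ trans _] [_ trans' _] cle] xy xz nyz.
have nyz' : ~ comparable le' y z by move=> /cle.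
have xz' : comparable le' x z by exact/cle.
split=> [xzE|].
  by apply/nyz; rewrite -xzE; exact: agree_comparable (agree_sym xy).
case: xy => _ [] [xy xy']; [left|right]; split.
- by case: xz => // zx; case: nyz; right; exact: trans zx xy.
- by case: xz' => // zx; case: nyz'; right; exact: trans' zx xy'.
- by case: xz => // zx; case: nyz; left; exact: trans xy zx.
- by case: xz' => // zx; case: nyz'; left; exact: trans' xy' zx.
Qed.

Lemma agree_forced le le' b c x y : compatible le le' -> agree le le' b c ->
  forced (comparable le) b c x y -> agree le le' x y.
Proof.
move=> cpt bc; elim=> {x y} [//|x y _ /agree_sym //|x y z _ xy].
exact: agree_step.
Qed.

(* Gallai's triangle lemma. *)
Lemma triangle_forced le le' a b c x y : compatible le le' ->
  agree le le' b c ->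
  agree le (converse le') a b -> agree le (converse le') a c ->
  forced (comparable le) b c x y ->
  agree le (converse le') a x /\ agree le (converse le') a y.
Proof.
move=> cpt bc ab ac; elim=> {x y} [//|x y _ []//|x y z f [ax ay] xz nyz].
split=> //.
have sxz : agree le le' x z by exact: agree_step (agree_forced cpt bc f) xz nyz.
have za : comparable le z a.
  exact: agree_triangle cpt (agree_sym sxz) (agree_sym ax).
have az : a <> z.
  move=> azE; apply: nyz; rewrite -azE.
  exact: agree_comparable (agree_sym ay).
(* If [a z] agreed, the disagreeing edge [a y] would make [z] and [y] comparable. *)
have [saz|//] := agree_or cpt az (comparable_sym za).
by case: nyz; apply/comparable_sym/(agree_triangle cpt (agree_sym saz) ay).
Qed.

Lemma agree_eq le le' : compatible le le' ->
  (forall x y, ~ agree le (converse le') x y) ->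
  forall x y, le x y <-> le' x y.
Proof.
move=> cpt nd x y; have [[refl _ anti] [refl' _ anti'] cle] := cpt.
have [->|xy] := pselect (x = y); first by split=> _; [exact: refl'|exact: refl].
split=> H.
  have [[_ [] []//]|/nd//] := agree_or cpt xy (or_introl H).
  by move=> yx _; case: xy; exact: anti.
have /cle cxy : comparable le' x y by left.
have [[_ [] []//]|/nd//] := agree_or cpt xy cxy.
by move=> _ yx; case: xy; exact: anti'.
Qed.

Section PrimeComp.
Variable le : V -> V -> Prop.
Hypothesis le_prime : prime_structure (Comp le).

(** The class of [b c] reaches [a] itself, where the triangle lemma would make [a] disagree with
    itself, although [agree] demands distinct vertices. *)
Lemma no_mixed_triangle le' a b c : compatible le le' -> agree le le' b c ->
  agree le (converse le') a b -> ~ agree le (converse le') a c.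
Proof.
move=> cpt bc ab ac.
have [y f] := forced_spanning le_prime bc.1 (agree_comparable bc) a.
by have [[]] := triangle_forced cpt bc ab ac f.
Qed.

(** The class of the disagreeing edge [d e] has an edge [b y] at [b]. The triangle [c b y] is then
    mixed, whichever way [c y] falls. *)
Lemma agree_uniform le' b c d e : compatible le le' ->
  agree le le' b c -> ~ agree le (converse le') d e.
Proof.
move=> cpt bc de; have cpt' := compatible_converse cpt.
have [y f] := forced_spanning le_prime de.1 (agree_comparable de) b.
have by_ := agree_forced cpt' de f.
have cy : comparable le c y by exact: agree_triangle cpt (agree_sym bc) by_.
have ncy : c <> y by move=> cyE; move: by_; rewrite -cyE; exact: agree_converse.
have [scy|dcy] := agree_or cpt ncy cy.
  exact: (@no_mixed_triangle (converse le') c b y cpt' by_ (agree_sym bc) scy).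
exact: (no_mixed_triangle cpt bc (agree_sym by_) (agree_sym dcy)).
Qed.

Lemma prime_Comp_orientation le' : partial_order le -> partial_order le' ->
  (forall x y, comparable le x y <-> comparable le' x y) ->
  (forall x y, le x y <-> le' x y) \/ (forall x y, le x y <-> le' y x).
Proof.
move=> ole ole' cle; have cpt : compatible le le' by split.
have [[d [e de]]|nd] := pselect (exists d e, agree le (converse le') d e).
  right; apply: (agree_eq (compatible_converse cpt)) => b c bc.
  exact: agree_uniform bc de.
by left; apply: agree_eq => // d e de; apply: nd; exists d, e.
Qed.

End PrimeComp.
End Orientations.

(** * Posets, graphs and bichains *)

Section Complements.
Implicit Types S T : structure unit.

Definition graph_compl S (j : unit) (x y : S) : Prop :=
  x <> y /\ ~ related j x y.

Definition incomparability S (_ : unit) (x y : S) : Prop :=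
  ~ related tt x y /\ ~ related tt y x.

Lemma graph_compl_embedding S T (f : S -> T) : embedding f ->
  @embedding unit (Structure (@graph_compl S)) (Structure (@graph_compl T)) f.
Proof.
move=> [fI fR]; split=> // i x y /=; rewrite /graph_compl fR.
split=> -[xy nr]; split=> //; first by move=> /fI.
by move=> xyE; apply: xy; rewrite xyE.
Qed.

(** A graph and its complement have the same modules: contraposition exchanges [a] and [a']. *)
Lemma prime_graph_compl S :
  prime_structure S <-> prime_structure (Structure (@graph_compl S)).
Proof.
have mE A : is_module (S := Structure (@graph_compl S)) A <->
    is_module (S := S) A.
  split=> mA v i a a' Av Aa Aa'.
    have av b : A b -> v <> b by move=> Ab vE; apply: Av; rewrite vE.
    have /= [H1 H2] := mA v i a' a Av Aa' Aa.
    split=> r; apply: contrapT => nr.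
      by have [] := H1 (conj (av _ Aa') nr).
    by have [] := H2 (conj (fun e => av _ Aa' (esym e)) nr).
  have av b : A b -> v <> b by move=> Ab vE; apply: Av; rewrite vE.
  have [H1 H2] := mA v i a' a Av Aa' Aa.
  split=> /= -[_ nr]; split; [exact: av|by move=> /H1| |by move=> /H2].
  by move=> /esym; exact: av.
by split=> pr A /mE /pr.
Qed.

End Complements.

Lemma graph_compl_Comp (V : Type) (le : V -> V -> Prop) : partial_order le ->
  Structure (@graph_compl (Comp le)) = Inc le.
Proof.
move=> [refl _ _]; congr Structure.
apply: funext => i; apply: funext => x; apply: funext => y; apply: propext.
rewrite /graph_compl /=; split=> [[xy nc]|[nxy nyx]].
  by split=> ?; apply: nc; split=> //; [left|right].
by split=> [xy|[_ [/nxy|/nyx]] //]; apply: nxy; rewrite xy; exact: refl.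
Qed.

Lemma graph_compl_Inc (V : Type) (le : V -> V -> Prop) :
  Structure (@graph_compl (Inc le)) = Comp le.
Proof.
congr Structure.
apply: funext => i; apply: funext => x; apply: funext => y; apply: propext.
rewrite /graph_compl /=; split=> [[xy nc]|[xy cxy]]; split=> //.
  apply: contrapT => nxy; apply: nc.
  by split=> ?; apply: nxy; [left|right].
by move=> [nxy nyx]; case: cxy.
Qed.

Lemma minimal_prime_graph_compl (S : structure unit) :
  minimal_prime (age S) -> minimal_prime (age (Structure (@graph_compl S))).
Proof.
apply: (@minimal_prime_F _ _ _ graph_compl_embedding setT) => // T _ _.
exact: prime_graph_compl.
Qed.

Lemma minimal_prime_Inc_Comp (V : Type) (le : V -> V -> Prop) :
  partial_order le ->
  minimal_prime (age (Inc le)) <-> minimal_prime (age (Comp le)).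
Proof.
move=> ole; split=> /minimal_prime_graph_compl.
  by rewrite graph_compl_Inc.
by rewrite graph_compl_Comp.
Qed.

Lemma prime_Inc_Comp (V : Type) (le : V -> V -> Prop) : partial_order le ->
  prime_structure (Inc le) <-> prime_structure (Comp le).
Proof.
move=> ole; rewrite -graph_compl_Comp //.
exact: iff_sym (prime_graph_compl _).
Qed.

Lemma structure_unitE (S : structure unit) : S = poset (@related unit S tt).
Proof. by case: S => V r; congr Structure; apply: funext => -[]. Qed.

Lemma minimal_prime_poset (V : Type) (le : V -> V -> Prop) : partial_order le ->
  minimal_prime (age (poset le)) <->
    minimal_prime (age (Inc le)) /\
    down_closure (Prim (age (poset le))) = age (poset le).
Proof.
move=> ole.
pose K : set (structure unit) := fun S => partial_order (@related unit S tt).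
apply: (@minimal_prime_F_iff _ _ incomparability _ K _ _
  (fun S i x y => related i y x)) => //.
- move=> S T f [fI fR]; split=> // i x y /=.
  by rewrite /incomparability !fR.
- move=> S T [refl trans anti] [f [fI fR]]; split=> [x|x y z|x y]; rewrite !fR.
  + exact: refl.
  + exact: trans.
  + by move=> xy yx; apply: fI; exact: anti.
- move=> S KS Sfin; rewrite (structure_unitE S).
  apply: (iff_trans (prime_poset_Comp Sfin KS)).
  exact: iff_sym (prime_Inc_Comp KS).
- by move=> S T f [fI fR]; split=> // i x y /=.
- by move=> S; exists id; split.
move=> X s u S U KS KU Sfin Sprime su.
(* Equal incomparability graphs make both orders orientations of one prime graph, so they are equal
   or dual. *)
have cE x y : comparable (s tt) x y <-> comparable (u tt) x y.
  have : incomparability (S := S) tt x y = incomparability (S := U) tt x y.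
    by rewrite su.
  rewrite /incomparability /= => iE.
  split=> c; apply: contrapT => nc.
    have [] : ~ s tt x y /\ ~ s tt y x.
      by rewrite iE; split=> ?; apply: nc; [left|right].
    by case: c.
  have [] : ~ u tt x y /\ ~ u tt y x.
    by rewrite -iE; split=> ?; apply: nc; [left|right].
  by case: c.
have pr : prime_structure (Comp (s tt)) by exact/prime_Inc_Comp.
have [E|E] := prime_Comp_orientation pr KS KU cE; [left|right];
  by exists id; split=> // -[] x y /=.
Qed.

Lemma minimal_prime_bichain (V : Type) (le1 le2 : V -> V -> Prop) :
  linear_order le1 -> linear_order le2 ->
  minimal_prime (age (bichain le1 le2)) <->
    minimal_prime (age (o_bichain le1 le2)) /\
    down_closure (Prim (age (bichain le1 le2))) = age (bichain le1 le2).
Proof.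
move=> lin1 lin2.
pose K : set (structure bool) := fun S =>
  linear_order (@related bool S true) /\ linear_order (@related bool S false).
pose o (S : structure bool) (_ : unit) (x y : S) :=
  related false x y /\ related true x y.
have structE S : S = bichain (@related bool S false) (@related bool S true).
  by case: S => X r; congr Structure; apply: funext => -[].
have linear_embedding (X Y : Type) (r : X -> X -> Prop) (q : Y -> Y -> Prop)
    (f : X -> Y) : injective f -> (forall x y, r x y <-> q (f x) (f y)) ->
    linear_order q -> linear_order r.
  move=> fI fR [[refl trans anti] tot]; split=> [|x y]; last by rewrite !fR.
  split=> [x|x y z|x y]; rewrite !fR; [exact: refl | exact: trans |].
  by move=> xy yx; apply: fI; exact: anti.
apply: (@minimal_prime_F_iff _ _ o _ K _ _
  (fun S i x y => related (~~ i) x y)) => //.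
- by move=> S T f [fI fR]; split=> // i x y; rewrite /= /o !fR.
- move=> S T [lt lf] [f [fI fR]].
  by split; [exact: linear_embedding fI (fR true) lt
            |exact: linear_embedding fI (fR false) lf].
- move=> S [lt lf] Sfin; rewrite (structE S).
  exact: (prime_bichain_o lf lt Sfin).
- by move=> S T f [fI fR]; split=> // i x y /=.
- by move=> S; exists id; split=> // -[].
move=> X s u S U [slt slf] [ult ulf] Sfin Sprime su.
pose ms x y := s false x y /\ s true x y.
pose ss x y := s false x y /\ s true y x.
pose us x y := u false x y /\ u true y x.
have mE x y : ms x y = (u false x y /\ u true x y).
  by have := congr1 (fun r => r tt x y) su.
have csms : complementary ms ss by exact: complementary_meet_skew.
have cums : complementary ms us.
  suff -> : ms = fun x y => u false x y /\ u true x y.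
    exact: complementary_meet_skew.
  by apply: funext => x; apply: funext => y.
have oss : partial_order ss by exact: partial_order_skew.
have ous : partial_order us by exact: partial_order_skew.
(* Both skew orders orient the complement of the same graph, which is prime. If they are equal the
   bichains coincide; if they are dual the two linear orders are exchanged. *)
have cE x y : comparable ss x y <-> comparable us x y.
  have [->|xy] := pselect (x = y).
    by split=> _; left; [case: ous | case: oss].
  exact: iff_trans (csms x y xy) (iff_sym (cums x y xy)).
have pr : prime_structure (Comp ss).
  apply: (complementary_prime_Comp csms).
  exact: (prime_poset_Comp Sfin (partial_order_meet slf slt)).1 Sprime.
have sP := @related_meet_skew X (s false) (s true) slf slt.
have uP := @related_meet_skew X (u false) (u true) ulf ult.
have [E|E] := prime_Comp_orientation pr oss ous cE; [left|right];
  exists id; split=> // -[] x y /=.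
- rewrite (sP x y).2 (uP x y).2 -mE; apply: or_iff_compat_l; exact: E.
- rewrite (sP x y).1 (uP x y).1 -mE; apply: or_iff_compat_l; exact: E.
- rewrite (sP x y).1 (uP x y).2 -mE; apply: or_iff_compat_l; exact: E.
- rewrite (sP x y).2 (uP x y).1 -mE; apply: or_iff_compat_l; exact: E.
Qed.

Theorem mainTheorem12 :
  (forall (V : Type) (le : V -> V -> Prop), partial_order le ->
     (minimal_prime (age (Inc le)) <-> minimal_prime (age (Comp le))) /\
     (minimal_prime (age (poset le)) <->
        minimal_prime (age (Inc le)) /\
        down_closure (Prim (age (poset le))) = age (poset le))) /\
  (forall (V : Type) (le1 le2 : V -> V -> Prop),
     linear_order le1 -> linear_order le2 ->
     (minimal_prime (age (bichain le1 le2)) <->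
        minimal_prime (age (o_bichain le1 le2)) /\
        down_closure (Prim (age (bichain le1 le2))) = age (bichain le1 le2))).
Proof.
split=> [V le ole|V le1 le2 lin1 lin2]; last exact: minimal_prime_bichain.
by split; [exact: minimal_prime_Inc_Comp | exact: minimal_prime_poset].
Qed.
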